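(* Let $\frac12<\alpha<1$ and $\vartheta:=\max\left\{\frac{5}{2-2\alpha},\frac{4+2\alpha}{2\alpha-1}\right\}$. There exist an integer $n_1\ge2$ and a constant $c>0$ such that the sequence defined by $n_k=(k-1)^{1/(2\alpha-1)}\,c\,n_{k-1}^{\vartheta}$ for $k\ge2$ satisfies $n_k^2>2n_{k-1}^2$ for all $k\ge2$, and such that the following holds. Let $X$ be the subordinator with drift $0$ and Lévy measure $\mu(dx)=\rho(x)dx$, where $$\rho(x)=\sum_{k=1}^\infty\frac{1}{x^{1+\alpha}}1_{\left(\frac{1}{2n_k^2},\frac{1}{n_k^2}\right)}(x),$$ and let $\psi$ be its Lévy–Khintchine exponent. Then there does not exist an increasing function $f$ on $[1,\infty)$ satisfying both $\int_N^\infty(\lambda f(\lambda))^{-1}d\lambda=\infty$ for some $N\ge1$ and $|1+\psi|\le(1+\mathrm{Re}(\psi))f(1+\mathrm{Re}(\psi))$ on $\mathbf{R}$.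
   Context: The subordinator with drift $0$ and Lévy measure $\mu$ on $(0,\infty)$, where $\int_{(0,\infty)}(1\wedge x)\mu(dx)<\infty$, is the increasing real-valued Lévy process $X$ with $E[e^{izX_t}]=e^{-t\psi(z)}$, $\psi(z)=\int_{(0,\infty)}(1-e^{izx})\mu(dx)$, $z\in\mathbf{R}$. ''Increasing'' means nondecreasing. *)

(* Defs.v *)
From HB Require Import structures.
From mathcomp Require Import all_boot all_order all_algebra.
From mathcomp Require Import all_classical all_reals all_analysis.
From mathcomp Require Import measurable_realfun complex.

Set Implicit Arguments.
Unset Strict Implicit.
Unset Printing Implicit Defensive.
Import Order.TTheory GRing.Theory Num.Theory.
Import numFieldNormedType.Exports.

Local Open Scope classical_set_scope.
Local Open Scope ring_scope.

(* e^{ix} for real x *)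
Definition expi {R : realType} (x : R) : R[i] := (cos x +i* sin x)%C.

Definition cexp {R : realType} (z : R[i]) : R[i] :=
  (expR (complex.Re z))%:C%C * expi (complex.Im z).

Definition cintegral d (T : measurableType d) (R : realType)
    (mu : {measure set T -> \bar R}) (D : set T) (f : T -> R[i]) : R[i] :=
  ((\int[mu]_(x in D) complex.Re (f x)) +i*
   (\int[mu]_(x in D) complex.Im (f x)))%C.

Section subordinators.
Context {R : realType}.

(* Measures on (0, oo) are represented by measures on R, of which only the
   restriction to (0, oo) is ever used. *)
Definition levy_measure (mu : {measure set (measurableTypeR R) -> \bar R}) :=
  (\int[mu]_(x in `]0%R, +oo[) (Num.min 1 x)%:E < +oo)%E.

Definition levy_exponent (mu : {measure set (measurableTypeR R) -> \bar R})
    (z : R) : R[i] :=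
  cintegral mu `]0, +oo[ (fun x : R => 1 - expi (z * x)).

(* The time parameter ranges over R, but X t only matters for 0 <= t. *)
Context d (Omega : measurableType d) (P : probability Omega R)
  (X : R -> {RV P >-> R}).

Definition increment (s t : R) (w : Omega) : R := X t w - X s w.

Definition independent_increments :=
  forall (n : nat) (t : nat -> R) (B : nat -> set R),
    0 <= t 0%N -> (forall i, t i <= t i.+1) ->
    (forall i, measurable (B i)) ->
  (P (\bigcap_(i < n) (increment (t i) (t i.+1) @^-1` B i)) =
   \prod_(i < n) P (increment (t i) (t i.+1) @^-1` B i))%E.

Definition stationary_increments :=
  forall (s t : R) (B : set R), 0 <= s -> s <= t -> measurable B ->
  P (increment s t @^-1` B) = P (increment 0 (t - s) @^-1` B).

Definition cadlag (g : R -> R) :=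
  forall t, 0 <= t ->
    g x @[x --> t^'+] --> g t /\ (0 < t -> cvg (g x @[x --> t^'-])).

Definition levy_process :=
  [/\ {ae P, forall w, X 0 w = 0},
      independent_increments, stationary_increments &
      {ae P, forall w, cadlag (fun t => X t w)}].

Definition is_exponent (psi : R -> R[i]) :=
  forall t z : R, 0 <= t ->
    cintegral P setT (fun w => expi (z * X t w)) = cexp (- (t%:C%C * psi z)).

Definition driftless_subordinator
    (mu : {measure set (measurableTypeR R) -> \bar R}) :=
  [/\ levy_process,
      {ae P, forall w, forall s t : R, 0 <= s -> s <= t -> X s w <= X t w},
      levy_measure mu & is_exponent (levy_exponent mu)].

End subordinators.

Section construction.
Context {R : realType}.

Definition vartheta (alpha : R) : R :=
  Num.max (5 / (2 - 2 * alpha)) ((4 + 2 * alpha) / (2 * alpha - 1)).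

(* For 1 <= k this is n_k; the value at k = 0 is never used. *)
Fixpoint scale (alpha c : R) (n1 k : nat) : R :=
  match k with
  | 0 => 1
  | 1 => n1%:R
  | k'.+1 => k'%:R `^ (1 / (2 * alpha - 1)) * c *
             scale alpha c n1 k' `^ vartheta alpha
  end.

(* The series is taken in \bar R, as the n_k are arbitrary here. *)
Definition levy_density (alpha : R) (n : nat -> R) (x : R) : \bar R :=
  (\sum_(1 <= k <oo)
    (1 / x `^ (1 + alpha) *
     \1_(`]1 / (2 * n k ^+ 2), 1 / n k ^+ 2[ : set R) x)%:E)%E.

Definition levy_density_measure (alpha : R) (n : nat -> R)
    (A : set (measurableTypeR R)) : \bar R :=
  (\int[lebesgue_measure]_(x in A) levy_density alpha n x)%E.

Let term_ge0 (alpha : R) (n : nat -> R) (k : nat) (x : R) :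
  (0 <= (1 / x `^ (1 + alpha) *
         \1_(`]1 / (2 * n k ^+ 2), 1 / n k ^+ 2[ : set R) x)%:E)%E.
Proof.
by rewrite lee_fin mulr_ge0 ?divr_ge0 ?powR_ge0.
Qed.

Lemma levy_density_ge0 alpha n x : (0 <= levy_density alpha n x)%E.
Proof. by apply: nneseries_ge0 => k _ _; exact: term_ge0. Qed.

Lemma measurable_levy_density alpha n :
  measurable_fun [set: R] (levy_density alpha n).
Proof.
under [levy_density alpha n]eq_fun do
  rewrite /levy_density -(nneseries_addn _ (term_ge0 alpha n ^~ _)).
apply: ge0_emeasurable_sum => [k x _ _|k _]; first exact: term_ge0.
apply/measurable_EFinP/measurable_funM; last exact: measurable_indic.
under eq_fun do rewrite div1r -powRN.
exact: measurable_powR.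
Qed.

Let levy_density_measure0 alpha n : levy_density_measure alpha n set0 = 0%E.
Proof. exact: integral_set0. Qed.

Let levy_density_measure_ge0 alpha n A :
  (0 <= levy_density_measure alpha n A)%E.
Proof. by apply: integral_ge0 => x _; exact: levy_density_ge0. Qed.

Let levy_density_measure_sigma_additive alpha n :
  semi_sigma_additive (levy_density_measure alpha n).
Proof.
move=> /= F mF tF mUF; rewrite /levy_density_measure; apply: cvg_toP.
  apply: ereal_nondecreasing_is_cvgn => m k mk.
  apply: lee_sum_nneg_natr => // j _ _; apply: integral_ge0 => /= x _.
  exact: levy_density_ge0.
rewrite ge0_integral_bigcup//=.
  by apply: measurable_funTS; exact: measurable_levy_density.
by move=> x _; exact: levy_density_ge0.
Qed.

HB.instance Definition _ alpha n := isMeasure.Build _ _ _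
  (levy_density_measure alpha n)
  (levy_density_measure0 alpha n) (levy_density_measure_ge0 alpha n)
  (@levy_density_measure_sigma_additive alpha n).

End construction.

(* The values of f outside [1, oo) are irrelevant. On [1, oo) the first and
   last clauses force 1 <= f, as psi 0 = 0 for an exponent, so the integrand is
   nonnegative and the inverse is never taken at 0. *)
Definition controls {R : realType} (psi : R -> R[i]) (f : R -> R) :=
  [/\ forall x y : R, 1 <= x -> x <= y -> f x <= f y,
      exists N : R, 1 <= N /\
        (\int[lebesgue_measure]_(x in `[N, +oo[) ((x * f x)^-1)%:E = +oo)%E &
      forall z : R, let u := 1 + complex.Re (psi z) in
        `|1 + psi z| <= (u * f u)%:C%C].

(* Main.v *)
Require Import Defs.
From mathcomp Require Import all_boot all_order all_algebra.
From mathcomp Require Import all_classical all_reals all_analysis.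
From mathcomp Require Import measurable_realfun complex ring lra.
Set Implicit Arguments.
Unset Strict Implicit.
Unset Printing Implicit Defensive.
Import Order.TTheory GRing.Theory Num.Theory.
Import numFieldNormedType.Exports.
Local Open Scope classical_set_scope.
Local Open Scope ring_scope.

(* Take c = 1 and n_1 = 8, and evaluate psi at z = n_k. With w = n_(k-1), the
   jumps larger than 1 / n_k^2 have total mass at most (2 w^2)^(1 + alpha),
   while the smaller ones contribute O(1) to Re psi, because
   1 - cos (z x) <= z^2 x^2 <= x there; hence 1 + Re psi = O(w^(2 + 2 alpha)).
   The k-th piece of rho contributes at least n_k^(2 alpha - 1) / 8 to |Im psi|,
   and n_k^(2 alpha - 1) >= w^(4 + 2 alpha) by the choice of theta. A
   nondecreasing f controlling psi must therefore exceed a multiple of w^2 from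
   O(w^4) on. Up to the threshold O(n_k^4) for the next k one has
   1 + ln l = O(w), so f(l) is at least a multiple of (1 + ln l)^2 for every
   l >= 1, and 1 / (l (1 + ln l)^2) has a finite integral.
   An exponent of X is unique, which reduces the statement on an arbitrary psi
   to the one on the Levy exponent of mu. *)

(** * Real-variable estimates *)

Section trigo_bounds.
Context {R : realType}.

Lemma norm_sin_le (y : R) : 0 <= y -> `|sin y| <= y.
Proof.
move=> y0; have [|c _] := @MVT_segment R sin cos 0 y y0.
  by apply: continuous_subspaceT; exact: continuous_sin.
rewrite sin0 !subr0 => ->; rewrite normrM (ger0_norm y0).
by apply: ler_piMl => //; exact: cos_max.
Qed.

(** By the mean value theorem the left side is [sin c * y] with [c <= y]; this loses a factor 2
    against the Taylor bound, which is harmless here. *)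
Lemma one_sub_cos_le (y : R) : 0 <= y -> 1 - cos y <= y ^+ 2.
Proof.
move=> y0; have [|c] := @MVT_segment R cos (fun x => - sin x) 0 y y0.
  by apply: continuous_subspaceT; exact: continuous_cos.
rewrite in_itv/= => /andP[c0 cy]; rewrite cos0 subr0 => cosE.
have -> : 1 - cos y = sin c * y by lra.
rewrite expr2 ler_wpM2r//; apply: le_trans cy; apply: le_trans (norm_sin_le c0).
exact: ler_norm.
Qed.

(** On [0, 1/2] the derivative [cos] is at least 3/4, by [one_sub_cos_le]. *)
Lemma half_le_sin (y : R) : 0 <= y <= 1 / 2 -> y / 2 <= sin y.
Proof.
move=> /andP[y0 y1]; have [|c] := @MVT_segment R sin cos 0 y y0.
  by apply: continuous_subspaceT; exact: continuous_sin.
rewrite in_itv/= => /andP[c0 cy]; rewrite sin0 !subr0 => ->.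
have := one_sub_cos_le c0 => H; rewrite mulrC ler_wpM2r//.
have : c ^+ 2 <= 1 / 2 * (1 / 2) by rewrite expr2 ler_pM//; lra.
by lra.
Qed.
End trigo_bounds.

Lemma div1_powR (R : realType) (x r : R) : 0 <= x -> 1 / x `^ r = x^-1 `^ r.
Proof.
by move=> x0; rewrite div1r -powRN -[- r]mulN1r powRrM powR_inv1.
Qed.

Lemma div1_powR_le (R : realType) (b x r : R) : 0 < b -> b <= x -> 0 <= r ->
  1 / x `^ r <= b^-1 `^ r.
Proof.
move=> b0 bx r0; have x0 := lt_le_trans b0 bx.
rewrite div1_powR ?(ltW x0)//.
by apply: ge0_ler_powR; rewrite ?nnegrE ?invr_ge0 ?(ltW x0) ?(ltW b0)// lef_pV2.
Qed.

(** * Comparison of 1 / (x f(x)) with 1 / (x (1 + ln x)^2) *)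

Section monotone_control.
Context {R : realType}.

(** The antiderivative [F] = -1 / (1 + ln x) rises from -1 at x = 1 to 0 at infinity. *)
Lemma integral_inv_mul_sqr_ln :
  (\int[lebesgue_measure]_(x in `[1%R, +oo[) ((x * (1 + ln x) ^+ 2)^-1 : R)%:E
    = 1)%E.
Proof.
pose g : R -> R := fun x => 1 + ln x.
pose F : R -> R := - (fun x => (g x)^-1).
have g0 (x : R) : 1 <= x -> 0 < g x.
  by move=> x1; have := ln_ge0 x1; rewrite /g; lra.
have dg (x : R) : 1 <= x -> is_derive x 1 g x^-1.
  move=> x1; have x0 : 0 < x by lra.
  have -> : g = cst 1 + @ln R by apply/funext.
  have dl := @is_derive1_ln R x x0.
  by apply: is_derive_eq; rewrite add0r.
have dF (x : R) : 1 <= x -> is_derive x 1 F (x * g x ^+ 2)^-1.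
  move=> x1; have nz : g x != 0 by rewrite gt_eqF// g0.
  have dV := is_deriveV nz (dg x x1).
  rewrite /F; apply: is_derive_eq; rewrite -scaleNr opprK /GRing.scale/=.
  by rewrite [RHS]invfM mulrC.
have cg (x : R) : 1 <= x -> {for x, continuous g}.
  move=> x1; apply/differentiable_continuous/derivable1_diffP.
  by have [] := dg x x1.
have cF (x : R) : 1 <= x -> {for x, continuous F}.
  move=> x1; apply/differentiable_continuous/derivable1_diffP.
  by have [] := dF x x1.
rewrite (@ge0_continuous_FTC2y R _ F 1 0).
- by rewrite /F /g /= fctE ln1 addr0 invr1 opprK add0e.
- move=> x x1; rewrite invr_ge0 mulr_ge0 ?sqr_ge0//; lra.
- apply: continuous_in_subspaceT => x; rewrite inE/= in_itv/= andbT => x1.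
  have gx0 := g0 x x1.
  apply: (@cvgV _ _ _ _ (fun x => x * g x ^+ 2)).
    by rewrite mulf_neq0 ?expf_neq0 ?gt_eqF//; lra.
  by apply: cvgM; [exact: cvg_id|apply: cvgM; exact: cg].
- rewrite /F -oppr0; apply: cvgN; apply/gtr0_cvgV0.
    by near=> x; apply: g0; near: x; exact: nbhs_pinfty_ge.
  apply/cvgryPge => A; near=> x.
  suff : expR A <= x.
    move=> eA; have : A <= ln x.
      by rewrite -[A]expRK ler_ln ?posrE ?expR_gt0//
                 (lt_le_trans _ eA)// expR_gt0.
    by rewrite /g; lra.
  by near: x; exact: nbhs_pinfty_ge.
- by move=> x x1; have [] := dF x (ltW x1).
- by apply: cvg_at_right_filter; exact: cF.
move=> x; rewrite in_itv/= andbT => x1.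
by rewrite derive1E; have [_ ->] := dF x (ltW x1).
Unshelve. all: by end_near. Qed.

Lemma sqr_ln_integral_lty (f : R -> R) (K N : R) :
  (forall x y, 1 <= x -> x <= y -> f x <= f y) -> 0 < K -> 1 <= N ->
  (forall x, 1 <= x -> (1 + ln x) ^+ 2 <= K * f x) ->
  (\int[lebesgue_measure]_(x in `[N, +oo[) ((x * f x)^-1)%:E < +oo)%E.
Proof.
move=> fnd K0 N1 fK.
have f0 x : 1 <= x -> 0 < f x.
  move=> x1; have := fK x x1; have := ln_ge0 x1 => l0 H.
  by rewrite -(pmulr_rgt0 _ K0); apply: lt_le_trans H; rewrite exprn_gt0//; lra.
(* Freezing [f] at [f 1] to the left of 1 gives a function monotone on the whole line, hence
   measurable. *)
pose h x := f (Num.max 1 x).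
have mh : measurable_fun [set: R] h.
  apply: nondecreasing_measurable => // x y xy; apply: fnd.
    by rewrite le_max lexx.
  by rewrite ge_max !le_max lexx xy orbT.
(* Measurability of an inverse is drawn from that of the power -1; the two agree on nonnegative
   arguments, whence the condition on [u]. *)
have mV (D : set R) (u v : R -> R) : measurable D ->
    measurable_fun [set: R] u -> (forall x, D x -> 0 <= u x /\ u x = v x) ->
    measurable_fun D (fun x => (v x)^-1).
  move=> mD mu uv.
  apply: (@eq_measurable_fun _ _ _ _ D (fun x => u x `^ (-1))).
    by move=> x /set_mem /uv[u0 <-]; rewrite powR_inv1.
  by apply: measurable_funTS; exact: (measurableT_comp (measurable_powR (-1)) mu).
have ml : measurable_fun [set: R] (fun x : R => x * (1 + ln x) ^+ 2).
  apply: measurable_funM => //; apply: measurable_funX.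
  by apply: measurable_funD => //; exact: measurable_ln.
have mlV (M : R) : 1 <= M -> measurable_fun `[M, +oo[
    (fun x : R => (x * (1 + ln x) ^+ 2)^-1).
  move=> M1; apply: (mV _ _ (fun x : R => x * (1 + ln x) ^+ 2) _ ml) => //= x.
  rewrite in_itv/= andbT => x1.
  by split => //; rewrite mulr_ge0 ?sqr_ge0//; lra.
apply: (@le_lt_trans _ _ (\int[lebesgue_measure]_(x in `[1%R, +oo[)
  (K%:E * ((x * (1 + ln x) ^+ 2)^-1)%:E))%E); last first.
  rewrite ge0_integralZl//=.
  - by rewrite integral_inv_mul_sqr_ln mule1 ltry.
  - by apply/measurable_EFinP; exact: mlV.
  - move=> x; rewrite in_itv/= andbT => x1.
    by rewrite lee_fin invr_ge0 mulr_ge0 ?sqr_ge0//; lra.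
  - by rewrite lee_fin ltW.
apply: (@le_trans _ _ (\int[lebesgue_measure]_(x in `[N, +oo[)
  (K%:E * ((x * (1 + ln x) ^+ 2)^-1)%:E))%E); last first.
  apply: ge0_subset_integral => //=.
  - apply: emeasurable_funM => //.
    by apply/measurable_EFinP; exact: mlV.
  - move=> x; rewrite in_itv/= andbT => x1.
    rewrite -EFinM lee_fin mulr_ge0 ?(ltW K0)// invr_ge0 mulr_ge0 ?sqr_ge0//.
    by rewrite (le_trans ler01 x1).
  - by move=> x /=; rewrite !in_itv/= !andbT; exact: le_trans.
apply: ge0_le_integral => //=.
- move=> x; rewrite in_itv/= andbT => Nx; have x1 : 1 <= x := le_trans N1 Nx.
  by rewrite lee_fin invr_ge0 mulr_ge0 ?(ltW (f0 x x1))//; lra.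
- apply/measurable_EFinP.
  apply: (mV _ (fun x => x * h x) (fun x => x * f x)) => //.
    exact: measurable_funM.
  move=> x /=; rewrite in_itv/= andbT => Nx; have x1 : 1 <= x := le_trans N1 Nx.
  rewrite /h max_r//; split => //.
  by rewrite mulr_ge0 ?(ltW (f0 x x1))//; lra.
- apply: emeasurable_funM => //.
  by apply/measurable_EFinP; exact: mlV.
move=> x; rewrite in_itv/= andbT => Nx; have x1 : 1 <= x := le_trans N1 Nx.
have fx0 := f0 x x1; have l0 := ln_ge0 x1; have H := fK x x1.
rewrite -EFinM lee_fin -[K]invrK -invfM lef_pV2 ?posrE; last 2 first.
- by rewrite mulr_gt0//; lra.
- by rewrite mulr_gt0 ?invr_gt0// mulr_gt0 ?exprn_gt0//; lra.
rewrite mulrCA ler_pM2l; last by lra.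
by rewrite mulrC ler_pdivrMr// mulrC.
Qed.

End monotone_control.

(** * The Levy density *)

Section density.
Context {R : realType}.
Variables (alpha : R) (n : nat -> R).
Hypothesis alpha_gt0 : 0 < alpha.
Hypothesis n1_ge1 : 1 <= n 1%N.
Hypothesis n_sep : forall k, (1 <= k)%N -> 2 * n k ^+ 2 <= n k.+1 ^+ 2.

Let piece k : set R := `]1 / (2 * n k ^+ 2), 1 / n k ^+ 2[.
Let term k (x : R) : \bar R := (1 / x `^ (1 + alpha) * \1_(piece k) x)%:E.

Lemma sqr_scale_le j k : (1 <= j)%N -> (j <= k)%N -> n j ^+ 2 <= n k ^+ 2.
Proof.
move=> j1 /subnKC <-; elim: (k - j)%N => [|i IH]; first by rewrite addn0.
rewrite addnS; apply: (le_trans IH); apply: le_trans (n_sep _); last first.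
  by rewrite (leq_trans j1) ?leq_addr.
by have := sqr_ge0 (n (j + i)); nra.
Qed.

Lemma sqr_scale_ge1 k : (1 <= k)%N -> 1 <= n k ^+ 2.
Proof.
by move=> k1; apply: le_trans (sqr_scale_le (leqnn 1) k1); rewrite exprn_ege1.
Qed.

Lemma sqr_scale_sep j k : (1 <= j)%N -> (j < k)%N -> 2 * n j ^+ 2 <= n k ^+ 2.
Proof.
by move=> j1 jk; apply: le_trans (n_sep j1) _; apply: sqr_scale_le.
Qed.

(** The factor 2 in [n_sep] puts the left end 1 / (2 n_j^2) of piece j at or beyond the right end of
    every later piece. *)
Lemma piece_inv_gt j k x : (1 <= j)%N -> (j < k)%N -> piece j x ->
  1 / n k ^+ 2 < x.
Proof.
move=> j1 jk; rewrite /piece /= in_itv /= => /andP[+ _]; apply: le_lt_trans.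
have := sqr_scale_sep j1 jk; have := sqr_scale_ge1 j1 => H1 H2.
by rewrite !div1r lef_pV2 ?posrE//; lra.
Qed.

Lemma piece_disjoint j k x : (1 <= j)%N -> (1 <= k)%N ->
  piece j x -> piece k x -> j = k.
Proof.
move=> j1 k1 pj pk.
have lt_k i l : piece i x -> 1 / n l ^+ 2 < x -> i != l.
  rewrite /piece /= in_itv /= => /andP[_ xi] lx; apply/eqP => il.
  by move: xi; rewrite il ltNge (ltW lx).
case: (ltngtP j k) => // jk.
  have := piece_inv_gt j1 jk pj.
  move: pk; rewrite /piece /= in_itv /= => /andP[_] /ltW.
  by rewrite leNgt => /negP.
have := piece_inv_gt k1 jk pk.
by move: pj; rewrite /piece /= in_itv /= => /andP[_] /ltW; rewrite leNgt => /negP.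
Qed.

Lemma levy_density_piece k x : (1 <= k)%N -> piece k x ->
  levy_density alpha n x = (1 / x `^ (1 + alpha))%:E.
Proof.
move=> k1 xk; rewrite /levy_density -/(term _ x).
have tk : term k x = (1 / x `^ (1 + alpha))%:E.
  by rewrite /term indicE mem_set// mulr1.
have t0 j : (1 <= j)%N -> j != k -> term j x = 0%E.
  move=> j1 jk; rewrite /term indicE memNset ?mulr0// => xj.
  by move/eqP: jk; apply; apply: piece_disjoint xj xk.
(* By disjointness only the k-th term survives, so the partial sums are constant as soon as m >
   k. *)
apply: lim_near_cst => //; near=> m.
have km : (k < m)%N by near: m; exists k.+1.
rewrite (bigD1_seq k) ?mem_index_iota ?iota_uniq ?k1//=.
rewrite big_nat_cond big1 ?addr0// => i /andP[/andP[i1 _] ik].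
exact: t0.
Unshelve. all: by end_near. Qed.

Lemma levy_density_off x : (forall k, (1 <= k)%N -> ~ piece k x) ->
  levy_density alpha n x = 0%E.
Proof.
move=> xN; rewrite /levy_density eseries0// => k k1 _.
by rewrite indicE memNset ?mulr0//; exact: xN.
Qed.

Lemma piece_gt0_lt1 k x : (1 <= k)%N -> piece k x -> 0 < x < 1.
Proof.
move=> k1; have := sqr_scale_ge1 k1 => n1.
rewrite /piece /= in_itv /= => /andP[lx xl]; apply/andP; split.
  by apply: le_lt_trans lx; rewrite divr_ge0//; lra.
by apply: lt_le_trans xl _; rewrite div1r invf_le1//; lra.
Qed.

(** All pieces lie in (0, 1), and on each of them the density is the single power x^-(1 + alpha);
    elsewhere it vanishes. *)
Lemma levy_density_measure_le (B : set R) (M : R) : measurable B -> 0 <= M ->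
  (forall k x, (1 <= k)%N -> piece k x -> B x -> 1 / x `^ (1 + alpha) <= M) ->
  (levy_density_measure alpha n B <=
    M%:E * lebesgue_measure (B `&` [set` `]0%R, 1%R[]))%E.
Proof.
move=> mB M0 HM; rewrite /levy_density_measure.
apply: (@le_trans _ _ (\int[lebesgue_measure]_(x in B)
    (M%:E * (\1_([set` `]0%R, 1%R[] : set R) x)%:E))%E).
  apply: ge0_le_integral => //.
  - by move=> x _; exact: levy_density_ge0.
  - by apply: measurable_funTS; exact: measurable_levy_density.
  - by apply/measurable_EFinP; apply: measurable_funM.
  move=> x Bx.
  have [[k [k1 kx]]|xN] := pselect (exists k, (1 <= k)%N /\ piece k x).
    rewrite (levy_density_piece k1 kx) indicE mem_set ?mule1 ?lee_fin; last first.
      by rewrite /= in_itv /=; exact: piece_gt0_lt1 kx.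
    exact: HM kx Bx.
  rewrite levy_density_off => [|k k1 kx]; last by apply: xN; exists k.
  by rewrite mule_ge0// lee_fin.
rewrite ge0_integralZl//; last by apply/measurable_EFinP; exact: measurable_indic.
by rewrite integral_indic// setIC.
Qed.

Lemma levy_density_measure_le1 (B : set R) (M : R) : measurable B -> 0 <= M ->
  (forall k x, (1 <= k)%N -> piece k x -> B x -> 1 / x `^ (1 + alpha) <= M) ->
  (levy_density_measure alpha n B <= M%:E)%E.
Proof.
move=> mB M0 HM; apply: (le_trans (levy_density_measure_le mB M0 HM)).
rewrite -[leRHS]mule1 lee_wpmul2l ?lee_fin//.
have -> : 1%E = lebesgue_measure [set` `]0%R, 1%R[ : interval R].
  by rewrite lebesgue_measure_itv/= lte01 sube0.
by apply: le_measure; rewrite ?inE//; exact: measurableI.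
Qed.

(** The piece has length 1 / (2 n_k^2), and the decreasing density is at least its value (n_k^2)^(1
    + alpha) at the right end. *)
Lemma levy_density_measure_piece k : (1 <= k)%N ->
  (((n k ^+ 2) `^ alpha / 2)%:E <= levy_density_measure alpha n (piece k))%E.
Proof.
move=> k1; have n1 := sqr_scale_ge1 k1.
have mp : measurable (piece k) by exact: measurable_itv.
have lp : lebesgue_measure (piece k) =
    (1 / n k ^+ 2 - 1 / (2 * n k ^+ 2))%:E.
  rewrite /piece lebesgue_measure_itv/= lte_fin.
  have -> : 1 / (2 * n k ^+ 2) < 1 / n k ^+ 2.
    by rewrite !div1r ltf_pV2 ?posrE//; lra.
  by rewrite -EFinD.
rewrite /levy_density_measure.
apply: (@le_trans _ _ (\int[lebesgue_measure]_(x in piece k)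
    (cst ((n k ^+ 2) `^ (1 + alpha))%:E x))%E).
  rewrite integral_cst// [X in (_ <= _ * X)%E]lp.
  rewrite -EFinM lee_fin powRD; last by apply/implyP => _; apply/eqP; lra.
  rewrite powRr1; last by lra.
  have -> : n k ^+ 2 * (n k ^+ 2) `^ alpha * (1 / n k ^+ 2 - 1 / (2 * n k ^+ 2)) =
    (n k ^+ 2) `^ alpha / 2.
    have : n k != 0 by apply/eqP => n0; move: n1; rewrite n0; lra.
    by move=> n0; field.
  exact: lexx.
apply: ge0_le_integral => //.
- by move=> x _; rewrite lee_fin powR_ge0.
- by apply: measurable_funTS; exact: measurable_levy_density.
move=> x xk; rewrite (levy_density_piece k1 xk) lee_fin.
have /andP[x0 x1] := piece_gt0_lt1 k1 xk.
rewrite div1_powR ?(ltW x0)//.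
apply: ge0_ler_powR; rewrite ?nnegrE ?invr_ge0 ?(ltW x0) ?sqr_ge0//.
  by rewrite addr_ge0// ltW.
move: xk; rewrite /piece /= in_itv /= => /andP[_].
rewrite div1r => xl; rewrite -[leLHS]invrK lef_pV2 ?posrE ?invr_gt0; lra.
Qed.

End density.

Lemma nneseries_ge_term (R : realType) (u : nat -> \bar R) (j : nat) :
  (forall i, 0 <= u i)%E -> (u j <= \sum_(0 <= i <oo) u i)%E.
Proof.
move=> u0; apply: le_trans (nneseries_lim_ge j.+1 (fun i _ _ => u0 i)).
by rewrite big_nat_recr//= leeDr// sume_ge0.
Qed.

(** * Dyadic decomposition of the half-line *)

Section dyadic.
Context {R : realType}.

(* The unbounded part makes [min 1 x <= 2^-1 ^+ j] solvable for every [x > 0]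
   (with [j = 0] when [1 < x]); it carries no jumps. *)
Definition dyadic_block (j : nat) : set R :=
  `]2^-1 ^+ j.+1, 2^-1 ^+ j] `|` `]1, +oo[.

Lemma measurable_dyadic_block j : measurable (dyadic_block j).
Proof. by apply: measurableU; exact: measurable_itv. Qed.

Lemma dyadic_block_cover (x : R) : 0 < x ->
  exists2 j, dyadic_block j x & Num.min 1 x <= 2^-1 ^+ j.
Proof.
move=> x0; have [x1|x1] := boolP (1 < x).
  exists 0%N; first by right; rewrite /= in_itv/= x1.
  by rewrite expr0 ge_min lexx.
have {}x1 : x <= 1 by rewrite leNgt.
have ex : exists j, (2^-1 : R) ^+ j.+1 < x.
  have := @cvg_expr R 2^-1; rewrite ger0_norm// => /(_ _)/cvgrPdist_lt.
  have h1 : (2^-1 : R) < 1 by rewrite invf_lt1// ltr1n.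
  move=> /(_ h1 _ x0)[j _ /(_ j.+1)] /= /(_ (leqnSn j)).
  by rewrite sub0r normrN ger0_norm ?exprn_ge0// => H; exists j.
(* Minimality of [j] yields the upper bound x <= 2^-j; for j = 0 this is x <= 1. *)
case: (ex_minnP ex) => j jx jmin; exists j.
  left; rewrite /= in_itv/= jx/=; case: j jx jmin => [|j] jx jmin //.
  by rewrite leNgt; apply/negP => /jmin; rewrite ltnn.
rewrite ge_min; apply/orP; right.
case: j jx jmin => [|j] jx jmin //.
by rewrite leNgt; apply/negP => /jmin; rewrite ltnn.
Qed.

(** The unbounded part of the block misses (0, 1), so only the length 2^-j - 2^-(j+1) of the dyadic
    interval counts. *)
Lemma dyadic_block_measure_le j :
  (lebesgue_measure (dyadic_block j `&` [set` `]0%R, 1%R[ : interval R])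
    <= (2^-1 ^+ j.+1)%:E)%E.
Proof.
apply: (@le_trans _ _ (lebesgue_measure
  [set` `]2^-1 ^+ j.+1, 2^-1 ^+ j] : interval R])).
  apply: le_measure; rewrite ?inE//.
    by apply: measurableI => //; exact: measurable_dyadic_block.
  move=> x [[//|]]; rewrite /= !in_itv/= andbT => x1 /andP[_ x1'].
  by move: (lt_trans x1 x1'); rewrite ltxx.
rewrite lebesgue_measure_itv/= lte_fin; case: ifP => _; last first.
  by rewrite lee_fin exprn_ge0.
by rewrite -EFinD lee_fin exprS; lra.
Qed.

End dyadic.

Lemma measurable_min1 (R : realType) :
  measurable_fun [set: R] (fun x => Num.min 1 x).
Proof.
apply: nondecreasing_measurable => // x y xy.
by rewrite le_min !ge_min lexx xy orbT.
Qed.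

Section Rintegral_indicator.
Context d (T : measurableType d) (R : realType).
Variables (mu : {measure set T -> \bar R}) (D A : set T).
Hypotheses (mD : measurable D) (mA : measurable A) (A_fin : (mu A < +oo)%E).

Lemma integrable_indicW : mu.-integrable D (EFin \o \1_A).
Proof.
apply/integrableP; split.
  by apply/measurable_EFinP/measurable_funTS; exact: measurable_indic.
under eq_integral => x _ do rewrite /= ger0_norm//.
rewrite integral_indic//; apply: le_lt_trans A_fin.
by apply: le_measure; rewrite ?inE//; exact: measurableI.
Qed.

Lemma Rintegral_indic : \int[mu]_(x in D) \1_A x = fine (mu (A `&` D)).
Proof. by rewrite /Rintegral integral_indic. Qed.

End Rintegral_indicator.

(** * Integrability of the Levy density and bounds on its exponent at a scale *)

Section levy_density_exponent.
Context {R : realType}.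
Variables (alpha : R) (n : nat -> R).
Hypothesis alpha_gt0 : 0 < alpha.
Hypothesis alpha_lt1 : alpha < 1.
Hypothesis n1_ge1 : 1 <= n 1%N.
Hypothesis n_sep : forall k, (1 <= k)%N -> 2 * n k ^+ 2 <= n k.+1 ^+ 2.

Let mu : {measure set (measurableTypeR R) -> \bar R} :=
  levy_density_measure alpha n.
Let piece k : set R := `]1 / (2 * n k ^+ 2), 1 / n k ^+ 2[.

(* [2^-1 ^+ j] bounds [x] on the block, and the measure of the block is of
   order 2^(j alpha), so the products decay geometrically as alpha < 1. *)
Lemma dyadic_block_levy_density_measure_le j :
  ((2^-1 ^+ j)%:E * mu (dyadic_block j) <=
    (geometric (2 * 2^-1 `^ (1 - alpha)) (2^-1 `^ (1 - alpha)) j)%:E)%E.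
Proof.
set b : R := 2^-1 ^+ j.+1.
have b0 : 0 < b by rewrite exprn_gt0.
(* The left end [b] of the block bounds the density there, and it is also the length of the dyadic
   interval. *)
have H : (mu (dyadic_block j) <= (b^-1 `^ (1 + alpha))%:E * b%:E)%E.
  apply: le_trans (levy_density_measure_le n1_ge1 n_sep
    (measurable_dyadic_block j) (powR_ge0 b^-1 (1 + alpha)) _) _.
    move=> k x k1 kx dx; apply: div1_powR_le => //; last first.
      by rewrite addr_ge0// ltW.
    have := piece_gt0_lt1 n1_ge1 n_sep k1 kx.
    case: dx; rewrite /= !in_itv/= => /andP[H1 H2].
      by move=> _; exact: ltW.
    by move=> /andP[_ /(lt_trans H1)]; rewrite ltxx.
  rewrite lee_wpmul2l ?lee_fin ?powR_ge0//.
  exact: dyadic_block_measure_le.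
apply: (@le_trans _ _ ((2^-1 ^+ j)%:E * ((b^-1 `^ (1 + alpha))%:E * b%:E))%E).
  by rewrite lee_wpmul2l// lee_fin exprn_ge0.
rewrite -!EFinM lee_fin /geometric /=.
have -> : 2 * 2^-1 `^ (1 - alpha) * 2^-1 `^ (1 - alpha) ^+ j =
    2 * b `^ (1 - alpha).
  rewrite -mulrA -exprS; congr (_ * _).
  by rewrite -powR_mulrn ?powR_ge0// powRAC powR_mulrn.
have -> : (2^-1 : R) ^+ j = 2 * b by rewrite /b exprS; lra.
have -> : b^-1 `^ (1 + alpha) = (b * b)^-1 * b `^ (1 - alpha).
  rewrite -div1_powR ?(ltW b0)// powRD ?powRB; first last.
  - by apply/implyP => _; rewrite gt_eqF.
  - by apply/implyP => _; rewrite gt_eqF.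
  rewrite powRr1 ?(ltW b0)//.
  have ba : b `^ alpha != 0 by rewrite gt_eqF// powR_gt0.
  have bn : b != 0 by rewrite gt_eqF.
  by field; rewrite ba bn.
have bn : b != 0 by rewrite gt_eqF.
rewrite le_eqVlt; apply/orP; left; apply/eqP; field.
by rewrite bn.
Qed.

(** Each x > 0 lies in a block with min(1, x) <= 2^-j, so min(1, x) is at most the sum of 2^-j times
    the block indicators; integrating termwise leaves a geometric series. *)
Lemma levy_measure_levy_density : levy_measure mu.
Proof.
rewrite /levy_measure.
have mb j := @measurable_dyadic_block R j.
set q : R := 2^-1 `^ (1 - alpha).
have q0 : 0 < q by rewrite powR_gt0.
have q1 : q < 1.
  have : q < 1 `^ (1 - alpha); last by rewrite powR1.
  apply: gt0_ltr_powR; rewrite ?nnegrE ?subr_gt0//.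
  by rewrite invf_lt1// ltr1n.
apply: (@le_lt_trans _ _ (\int[mu]_(x in `]0%R, +oo[)
   (\sum_(0 <= j <oo) ((2^-1 ^+ j)%:E * (\1_(dyadic_block j) x)%:E)))%E).
  apply: ge0_le_integral => //.
  - by move=> x; rewrite /= in_itv/= andbT lee_fin le_min ler01/=; exact: ltW.
  - by apply/measurable_EFinP/measurable_funTS; exact: measurable_min1.
  - apply: ge0_emeasurable_sum => [k x _ _|k _].
      by rewrite -EFinM lee_fin mulr_ge0 ?exprn_ge0.
    apply: emeasurable_funM => //; apply/measurable_EFinP.
    by apply: measurable_indic; exact: mb.
  move=> x; rewrite /= in_itv/= andbT => x0.
  have [j jx xj] := dyadic_block_cover x0.
  apply: le_trans; last first.
    apply: (@nneseries_ge_term _ _ j) => i.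
    by rewrite -EFinM lee_fin mulr_ge0 ?exprn_ge0.
  by rewrite indicE mem_set// mule1 lee_fin.
rewrite integral_nneseries//; last first.
  move=> j; apply: emeasurable_funM => //; apply/measurable_EFinP.
  by apply: measurable_indic; exact: mb.
have tE j : (\int[mu]_(x in `]0%R, +oo[)
      ((2^-1 ^+ j)%:E * (\1_(dyadic_block j) x)%:E)
   <= (geometric (2 * q) q j)%:E)%E.
  rewrite ge0_integralZl//; last first.
    by apply/measurable_EFinP; apply: measurable_indic; exact: mb.
  apply: le_trans (dyadic_block_levy_density_measure_le j).
  rewrite integral_indic; [|by []|exact: mb].
  apply: lee_wpmul2l; first by rewrite lee_fin exprn_ge0.
  apply: le_measure; rewrite ?inE//.
    by apply: measurableI => //; exact: mb.
  exact: mb.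
apply: (@le_lt_trans _ _ (2 * q / (1 - q))%:E); last exact: ltry.
apply: lime_le.
  apply: is_cvg_nneseries => j _ _; apply: integral_ge0 => x _.
  by rewrite -EFinM lee_fin mulr_ge0 ?exprn_ge0.
apply: nearW => m.
apply: (@le_trans _ _ (series (geometric (2 * q) q) m)%:E).
  by rewrite /series /= -sumEFin; apply: lee_sum => j _; exact: tE.
rewrite lee_fin; apply: geometric_le_lim => //.
- by rewrite mulr_ge0// ltW.
- by rewrite ger0_norm// ltW.
Qed.


(** The value of x^-(1 + alpha) at the left end of piece k, hence a bound for the density on the
    pieces 1 to k. *)
Let M k : R := (2 * n k ^+ 2) `^ (1 + alpha).

(** Only the pieces 1 to k reach beyond 1 / n_(k+1)^2; there the density is at most [M k], and they
    all lie in an interval of length 1. *)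
Lemma levy_density_tail_le k : (1 <= k)%N ->
  (mu [set` `]((n k.+1 ^+ 2)^-1)%R, +oo[ : interval R] <= (M k)%:E)%E.
Proof.
move=> k1; apply: levy_density_measure_le1 => //; first exact: powR_ge0.
move=> j x j1; rewrite /= !in_itv/= andbT !div1r => /andP[lx xl] vx.
have jk : (j <= k)%N.
  rewrite leqNgt; apply/negP => kj.
  have := sqr_scale_le n_sep (ltn0Sn k) kj.
  have := sqr_scale_ge1 n1_ge1 n_sep j1.
  have := sqr_scale_ge1 n1_ge1 n_sep (ltn0Sn k) => n1 n2 n3.
  have := lt_trans vx xl; rewrite ltf_pV2 ?posrE; lra.
have := sqr_scale_le n_sep j1 jk => njk.
have := sqr_scale_ge1 n1_ge1 n_sep j1; have := sqr_scale_ge1 n1_ge1 n_sep k1.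
move=> n1 n2; rewrite -div1r /M -[2 * n k ^+ 2]invrK; apply: div1_powR_le.
- by rewrite invr_gt0; lra.
- by apply: le_trans (ltW lx); rewrite lef_pV2 ?posrE; lra.
- by rewrite addr_ge0// ltW.
Qed.

Lemma levy_density_piece_lty k : (1 <= k)%N -> (mu (piece k) < +oo)%E.
Proof.
move=> k1; apply: (@le_lt_trans _ _ (M k)%:E); last exact: ltry.
apply: levy_density_measure_le1 => //.
- exact: measurable_itv.
- exact: powR_ge0.
have := sqr_scale_ge1 n1_ge1 n_sep k1 => n1.
move=> j x _ _; rewrite /piece /= in_itv/= div1r => /andP[lx _].
rewrite /M -[2 * n k ^+ 2]invrK; apply: div1_powR_le.
- by rewrite invr_gt0; lra.
- exact: ltW.
- by rewrite addr_ge0// ltW.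
Qed.

Lemma integrable_min1 :
  mu.-integrable `]0, +oo[ (EFin \o (fun x : R => Num.min 1 x)).
Proof.
apply/integrableP; split.
  by apply/measurable_EFinP/measurable_funTS; exact: measurable_min1.
apply: le_lt_trans levy_measure_levy_density.
under eq_integral => x.
  rewrite inE/= in_itv/= andbT => x0.
  rewrite ger0_norm; last by rewrite le_min ler01 ltW.
  over.
by [].
Qed.

Let C : R := \int[mu]_(x in `]0, +oo[) Num.min 1 (x : R).

Lemma Re_levy_exponent_scale_le k : (1 <= k)%N -> 1 <= n k.+1 ->
  0 <= complex.Re (levy_exponent mu (n k.+1)) <= C + 2 * M k.
Proof.
move=> k1 v1; rewrite /levy_exponent /cintegral /=; set v := n k.+1.
have v0 : 0 < v by rewrite /v; lra.
rewrite (@eq_Rintegral _ _ _ mu _ (fun x : R => 1 - cos (v * x))); last by [].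
have cos0 x : 0 <= 1 - cos (v * x) by rewrite subr_ge0 cos_le1.
apply/andP; split; first by apply: Rintegral_ge0.
pose A : set R := [set` `]((v ^+ 2)^-1), +oo[ : interval R].
have muA : (mu A <= (M k)%:E)%E := levy_density_tail_le k1.
have muAoo : (mu A < +oo)%E by apply: le_lt_trans muA _; exact: ltry.
have mA : measurable A by exact: measurable_itv.
have iA := @integrable_indicW _ _ R mu `]0, +oo[%classic A
  (measurable_itv _) mA muAoo.
(* On [A] the trivial bound 2 is used; off [A], v^2 x <= 1 turns the quadratic bound v^2 x^2 into x,
   which is then min(1, x). *)
have bnd x : 0 < x -> 1 - cos (v * x) <= Num.min 1 x + 2 * \1_A x.
  move=> x0; have mx : 0 <= Num.min 1 x by rewrite le_min ler01 ltW.
  rewrite indicE; case: (boolP (x \in A)) => [_|].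
    by rewrite mulr1; have := cos_geN1 (v * x); lra.
  rewrite notin_setE /A /= in_itv/= andbT => /negP; rewrite -leNgt => xv.
  rewrite mulr0 addr0.
  have vx : v ^+ 2 * x <= 1.
    by rewrite -ler_pdivlMl ?exprn_gt0// mulr1.
  have x1 : x <= 1.
    apply: le_trans xv _; rewrite invf_le1 ?exprn_gt0//.
    by rewrite exprn_ege1.
  rewrite min_r//; apply: le_trans (one_sub_cos_le _) _.
    by rewrite mulr_ge0 ?ltW.
  by rewrite exprMn [x ^+ 2]expr2 mulrA ler_piMl// ltW.
have imin := integrable_min1.
have i2A : mu.-integrable `]0, +oo[ (EFin \o (fun x : R => 2 * \1_A x)).
  exact: integrableZl iA.
have iS : mu.-integrable `]0, +oo[
    (EFin \o (fun x : R => Num.min 1 x + 2 * \1_A x)).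
  exact: integrableD imin i2A.
have mcos : measurable_fun [set: R] (fun x : R => 1 - cos (v * x)).
  apply: measurable_funB => //.
  apply: measurableT_comp; last exact: measurable_funM.
  by apply: continuous_measurable_fun; exact: continuous_cos.
apply: (@le_trans _ _ (\int[mu]_(x in `]0, +oo[)
    (Num.min 1 (x : R) + 2 * \1_A x))).
  apply: le_Rintegral => //.
    apply: le_integrable iS => //.
      by apply/measurable_EFinP/measurable_funTS.
    move=> x; rewrite /= in_itv/= andbT => x0.
    rewrite lee_fin ger0_norm// ler_normr; apply/orP; left; exact: bnd.
  by move=> x; rewrite /= in_itv/= andbT => x0; exact: bnd.
rewrite RintegralD// lerD2l RintegralZl// ler_wpM2l//.
rewrite Rintegral_indic//.
apply: (@le_trans _ _ (fine (M k)%:E)); last by [].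
apply: fine_le => //.
  rewrite ge0_fin_numE//; apply: le_lt_trans muAoo.
  by apply: le_measure; rewrite ?inE//; exact: measurableI.
apply: le_trans muA; apply: le_measure; rewrite ?inE//; exact: measurableI.
Qed.

Lemma Im_levy_exponent_scale_le k : (1 <= k)%N -> 2 <= n k.+1 ->
  complex.Im (levy_exponent mu (n k.+1)) <=
    M k - (n k.+1 ^+ 2) `^ alpha / (8 * n k.+1).
Proof.
move=> k1; rewrite /levy_exponent /cintegral /=; set v := n k.+1 => v2.
have v0 : 0 < v by lra.
have v2_ge1 : 1 <= v ^+ 2 by rewrite exprn_ege1//; lra.
rewrite (@eq_Rintegral _ _ _ mu _ (fun x => - sin (v * x))); last first.
  by move=> x _; rewrite /= add0r.
pose A : set R := [set` `]((v ^+ 2)^-1), +oo[ : interval R].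
pose B := piece k.+1.
have muA : (mu A <= (M k)%:E)%E := levy_density_tail_le k1.
have muAoo : (mu A < +oo)%E by apply: le_lt_trans muA _; exact: ltry.
have mA : measurable A by exact: measurable_itv.
have mB : measurable B by exact: measurable_itv.
have muBoo : (mu B < +oo)%E := levy_density_piece_lty (ltn0Sn k).
have iA := @integrable_indicW _ _ R mu `]0, +oo[%classic A
  (measurable_itv _) mA muAoo.
have iB := @integrable_indicW _ _ R mu `]0, +oo[%classic B
  (measurable_itv _) mB muBoo.
(* On [B] one has x > 1 / (2 v^2), so sin(vx) >= vx / 2 > 1 / (4 v). Off [A] the angle vx is at most
   1 / v <= 1/2, so the sine is nonnegative there. *)
pose s := (4 * v)^-1.
have s0 : 0 < s by rewrite invr_gt0; lra.
have bnd x : 0 < x -> - sin (v * x) <= \1_A x - s * \1_B x.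
  move=> x0; rewrite !indicE; case: (boolP (x \in A)) => [xA|].
    rewrite [x \in B]memNset ?mulr0 ?subr0; last first.
      rewrite /B /piece /= in_itv/= => /andP[_ /ltW]; rewrite leNgt => /negP.
      by apply; move: xA; rewrite inE /A /= in_itv/= andbT div1r.
    by rewrite lerNl; exact: sin_geN1.
  rewrite notin_setE /A /= in_itv/= andbT => /negP; rewrite -leNgt => xv.
  rewrite sub0r lerN2.
  have vx : v * x <= v^-1.
    by rewrite -ler_pdivlMl// -invfM -expr2.
  have vV : v^-1 <= 1 / 2 by rewrite div1r lef_pV2 ?posrE//; lra.
  have y01 : 0 <= v * x <= 1 / 2.
    by rewrite mulr_ge0 ?(ltW x0) ?(ltW v0)//= (le_trans vx).
  apply: le_trans (half_le_sin y01).
  case: (boolP (x \in B)) => [|_]; last first.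
    by rewrite mulr0 divr_ge0//; case/andP: y01.
  rewrite inE /B /piece /= in_itv/= => /andP[xB _].
  rewrite mulr1 /s invfM mulrC.
  have -> : (4 : R)^-1 = 2^-1 / 2 by lra.
  rewrite mulrA ler_wpM2r//.
  apply: le_trans (ler_wpM2l (ltW v0) (ltW xB)).
  rewrite le_eqVlt; apply/orP; left; apply/eqP.
  have vn : v != 0 by rewrite gt_eqF.
  by rewrite -/v; field.
have isB : mu.-integrable `]0, +oo[ (EFin \o (fun x : R => s * \1_B x)).
  exact: integrableZl iB.
have iS : mu.-integrable `]0, +oo[
    (EFin \o (fun x : R => \1_A x - s * \1_B x)).
  exact: integrableB iA isB.
have msin : measurable_fun [set: R] (fun x : R => - sin (v * x)).
  apply: measurableT_comp => //.
  apply: measurableT_comp; last exact: measurable_funM.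
  by apply: continuous_measurable_fun; exact: continuous_sin.
(* A dominating function for sin(vx): |sin(vx)| is at most vx for x < 1, and at most 1 <= v
   otherwise. *)
have ismin : mu.-integrable `]0, +oo[
    (EFin \o (fun x : R => v * Num.min 1 x)).
  exact: integrableZl integrable_min1.
apply: (@le_trans _ _ (\int[mu]_(x in `]0, +oo[)
    (\1_A x - s * \1_B x))).
  apply: le_Rintegral => //.
    apply: le_integrable ismin => //.
      by apply/measurable_EFinP/measurable_funTS.
    move=> x; rewrite /= in_itv/= andbT => x0.
    rewrite lee_fin normrN ler_normr; apply/orP; left.
    rewrite minEle; case: ifP => _.
      by apply: le_trans (sin_max _) _; rewrite mulr1; lra.
    by apply: norm_sin_le; rewrite mulr_ge0// ltW.
  by move=> x; rewrite /= in_itv/= andbT => x0; exact: bnd.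
rewrite RintegralB// RintegralZl// !Rintegral_indic//.
apply: lerB.
  apply: (@le_trans _ _ (fine (M k)%:E)); last by [].
  apply: fine_le => //.
    rewrite ge0_fin_numE//; apply: le_lt_trans muAoo.
    by apply: le_measure; rewrite ?inE//; exact: measurableI.
  apply: le_trans muA; apply: le_measure; rewrite ?inE//; exact: measurableI.
have -> : (v ^+ 2) `^ alpha / (8 * v) = s * ((v ^+ 2) `^ alpha / 2).
  by rewrite /s; field; rewrite gt_eqF.
rewrite ler_wpM2l ?(ltW s0)//.
have -> : B `&` `]0, +oo[ = B.
  apply: setIidl => x /(piece_gt0_lt1 n1_ge1 n_sep (ltn0Sn k)) /andP[x0 _].
  by rewrite /= in_itv/= x0.
rewrite -[leLHS]/(fine ((v ^+ 2) `^ alpha / 2)%:E); apply: fine_le => //.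
  by rewrite ge0_fin_numE.
exact: levy_density_measure_piece.
Qed.

End levy_density_exponent.

(** * The scales and the exponent *)

Lemma norm_1_add_ge_Im (R : realType) (z : R[i]) (r : R) :
  `|1 + z| <= r%:C%C -> - complex.Im z <= r.
Proof.
case: z => a b; rewrite normc_def lecR /= add0r; apply: le_trans.
apply: (@le_trans _ _ (Num.sqrt (b ^+ 2))).
  by rewrite sqrtr_sqr -normrN ler_norm.
by apply: ler_wsqrtr; rewrite lerDr sqr_ge0.
Qed.

Lemma norm_1_add_ge_Re (R : realType) (z : R[i]) (r : R) :
  `|1 + z| <= r%:C%C -> 1 + complex.Re z <= r.
Proof.
case: z => a b /(le_trans (normc_ge_Re _)); rewrite lecR /=.
exact/le_trans/ler_norm.
Qed.

(** * Uniqueness of the characteristic exponent *)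

Section exponent_uniqueness.
Context {R : realType}.

(** Equal moduli give equal real parts. The imaginary parts are determined only modulo 2 pi, which
    the cosine of their difference records. *)
Lemma cexp_eq (u w : R[i]) : cexp u = cexp w ->
  complex.Re u = complex.Re w /\ cos (complex.Im u - complex.Im w) = 1.
Proof.
case: u w => [a x] [b y]; rewrite /cexp /expi /=.
have a0 := expR_gt0 a; have b0 := expR_gt0 b.
set A := expR a in a0 *; set B := expR b in b0 *.
move=> [ce se].
have {}ce : A * cos x = B * cos y by lra.
have {}se : A * sin x = B * sin y by lra.
have cx := cos2Dsin2 x; have cy := cos2Dsin2 y.
have AB : A = B.
  apply/eqP; rewrite -(@eqrXn2 _ 2) ?ltW//; apply/eqP.
  have -> : A ^+ 2 = (A * cos x) ^+ 2 + (A * sin x) ^+ 2.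
    by rewrite !exprMn -mulrDr cx mulr1.
  by rewrite ce se !exprMn -mulrDr cy mulr1.
move: ce se; rewrite AB => /mulfI ce /mulfI se.
have B0 : B != 0 by rewrite gt_eqF.
split; first exact: expR_inj.
by rewrite cosB (ce B0) (se B0) -!expr2.
Qed.

(* At the time t = pi / |Im a - Im b| the two exponentials would differ by the
   factor -1. *)
Lemma cexp_ray_inj (a b : R[i]) :
  (forall t : R, 0 <= t -> cexp (- (t%:C%C * a)) = cexp (- (t%:C%C * b))) ->
  a = b.
Proof.
case: a b => [a x] [b y] E.
have E' t : 0 <= t -> t * a = t * b /\ cos (t * (x - y)) = 1.
  move=> t0; have [/= H1 H2] := cexp_eq (E t t0); split; first lra.
  by rewrite -H2 -cosN; congr cos; lra.
have [|ab _] := E' 1; first by [].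
congr (_ +i* _)%C; first by lra.
apply/eqP; rewrite -subr_eq0; apply/negP => /negP d0.
have nd0 : 0 < `|x - y| by rewrite normr_gt0.
have [|_ ] := E' (pi / `|x - y|); first by rewrite divr_ge0 ?pi_ge0.
rewrite -cos_norm normrM ger0_norm ?divr_ge0 ?pi_ge0// divfK ?gt_eqF// cospi.
by lra.
Qed.

(** For fixed z both exponentials equal the characteristic function of X_t at z for every t >= 0; a
    single time would leave the imaginary part ambiguous. *)
Lemma is_exponent_unique d (Omega : measurableType d) (P : probability Omega R)
    (X : R -> {RV P >-> R}) (psi1 psi2 : R -> R[i]) :
  is_exponent X psi1 -> is_exponent X psi2 -> psi1 = psi2.
Proof.
move=> e1 e2; apply/funext => z; apply: cexp_ray_inj => t t0.
by rewrite -(e1 _ _ t0) (e2 _ _ t0).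
Qed.

End exponent_uniqueness.

(** * Growth of the scales n_k *)

Section scale_growth.
Context {R : realType}.
Variable alpha : R.
Hypotheses (alpha_gt : 1 / 2 < alpha) (alpha_lt : alpha < 1).

Local Notation theta := (vartheta alpha).
Local Notation p := (1 / (2 * alpha - 1)).
Local Notation s := (scale alpha 1 8).

Let a21 : 0 < 2 * alpha - 1.
Proof. by have := alpha_gt; lra. Qed.

Let p_ge0 : 0 <= p.
Proof. by rewrite divr_ge0// ltW. Qed.

(** The first entry of the maximum already exceeds 5, as 0 < 2 - 2 alpha < 1. *)
Lemma vartheta_ge2 : 2 <= theta.
Proof.
rewrite /vartheta le_max; apply/orP; left.
have := alpha_gt; have := alpha_lt => al ag.
by rewrite ler_pdivlMr; lra.
Qed.

Lemma vartheta_mul_ge : 4 + 2 * alpha <= theta * (2 * alpha - 1).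
Proof.
rewrite -ler_pdivrMr// /theta /vartheta le_max; apply/orP; right; exact: lexx.
Qed.

Lemma scaleS k : (1 <= k)%N -> s k.+1 = k%:R `^ p * s k `^ theta.
Proof. by case: k => // k _; rewrite /= mulr1. Qed.

Lemma scale_ge_powR k : (1 <= k)%N -> s k `^ theta <= s k.+1.
Proof.
move=> k1; rewrite scaleS// ler_peMl ?powR_ge0//.
by rewrite -[leLHS](powRr0 k%:R) ler_powR// ler1n.
Qed.

Lemma scale_ge_sqr k : (1 <= k)%N -> 1 <= s k -> s k ^+ 2 <= s k.+1.
Proof.
move=> k1 s1; apply: le_trans (scale_ge_powR k1).
by rewrite -powR_mulrn ?(le_trans ler01)// ler_powR// vartheta_ge2.
Qed.

Lemma scale_ge8 k : (1 <= k)%N -> 8 <= s k.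
Proof.
case: k => // k _; elim: k => [|k IH]; first by [].
have s1 : 1 <= s k.+1 by lra.
by have := scale_ge_sqr (ltn0Sn k) s1; nra.
Qed.

(** Serves to absorb the factor k^p of the recursion in logarithmic bounds, and shows that the
    scales are unbounded. *)
Lemma scale_ge_nat k : (1 <= k)%N -> k%:R <= s k.
Proof.
case: k => // k _; elim: k => [|k IH]; first by rewrite /=; lra.
have s8 := scale_ge8 (ltn0Sn k); have s1 : 1 <= s k.+1 by lra.
have := scale_ge_sqr (ltn0Sn k) s1.
by rewrite -[k.+2%:R]natr1; nra.
Qed.

Lemma scale_sqr_sep k : (1 <= k)%N -> 2 * s k ^+ 2 < s k.+1 ^+ 2.
Proof.
move=> k1; have s8 := scale_ge8 k1; have s1 : 1 <= s k by lra.
have b8 : 8 * s k <= s k.+1 by have := scale_ge_sqr k1 s1; nra.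
have : (8 * s k) * (8 * s k) <= s k.+1 * s k.+1 by apply: ler_pM; lra.
by rewrite -!expr2 exprMn; nra.
Qed.

(** The recursion gives ln n_(k+1) = p ln k + theta ln n_k; then ln y < y and k <= n_k. *)
Lemma ln_scale_le k : (1 <= k)%N -> ln (s k.+1) <= (p + theta) * s k.
Proof.
move=> k1; have s8 := scale_ge8 k1; have sk := scale_ge_nat k1.
have k0 : 0 < k%:R :> R by rewrite ltr0n.
have s0 : 0 < s k by lra.
rewrite scaleS// lnM ?posrE ?powR_gt0// !ln_powR [leRHS]mulrDl.
have t2 := vartheta_ge2.
apply: lerD; apply: ler_wpM2l => //.
- by apply: ltW; apply: lt_le_trans (ln_sublinear k0) _.
- by lra.
- by apply: ltW; exact: ln_sublinear.
Qed.

(** The right side is n_(k+1)^(2 alpha - 1), at least n_k^(theta (2 alpha - 1)); the second entry of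
    the maximum defining theta makes this exponent at least 4 + 2 alpha. *)
Lemma scale_powR_ge k : (1 <= k)%N ->
  s k ^+ 2 * s k `^ (2 + 2 * alpha) <= (s k.+1 ^+ 2) `^ alpha / s k.+1.
Proof.
move=> k1; have s8 := scale_ge8 k1; have t8 := scale_ge8 (ltn0Sn k).
have s0 : 0 < s k by lra.
have t0 : 0 < s k.+1 by lra.
have -> : (s k.+1 ^+ 2) `^ alpha / s k.+1 = s k.+1 `^ (2 * alpha - 1).
  rewrite powRB; last by apply/implyP => _; rewrite gt_eqF.
  by rewrite powRr1 ?(ltW t0)// powRrM powR_mulrn// ltW.
rewrite -powR_mulrn ?(ltW s0)// -powRD; last first.
  by apply/implyP => _; rewrite gt_eqF.
apply: (@le_trans _ _ ((s k `^ theta) `^ (2 * alpha - 1))).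
  by rewrite -powRrM ler_powR//; have := vartheta_mul_ge; lra.
apply: ge0_ler_powR; rewrite ?nnegrE ?powR_ge0 ?(ltW t0) ?(ltW a21)//.
exact: scale_ge_powR.
Qed.

Lemma scale_mass_le k : (1 <= k)%N ->
  (2 * s k ^+ 2) `^ (1 + alpha) <= 4 * s k `^ (2 + 2 * alpha).
Proof.
move=> k1; have s8 := scale_ge8 k1.
have s0 : 0 <= s k by lra.
rewrite powRM ?sqr_ge0//.
have -> : (s k ^+ 2) `^ (1 + alpha) = s k `^ (2 + 2 * alpha).
  by rewrite -powR_mulrn// -powRrM; congr (_ `^ _); lra.
apply: ler_wpM2r; first exact: powR_ge0.
have -> : 4 = 2 `^ 2%:R :> R by rewrite powR_mulrn//; lra.
by have := alpha_lt => al; apply: ler_powR; lra.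
Qed.

End scale_growth.

(** * Contradiction with a controlling function *)

Section no_control.
Context {R : realType}.
Variable alpha : R.
Hypotheses (alpha_gt : 1 / 2 < alpha) (alpha_lt : alpha < 1).

Local Notation s := (scale alpha 1 8).

Let mu : {measure set (measurableTypeR R) -> \bar R} :=
  levy_density_measure alpha s.

Let alpha_gt0 : 0 < alpha.
Proof. by have := alpha_gt; lra. Qed.

Let s1_ge1 : 1 <= s 1%N.
Proof. by rewrite /=; lra. Qed.

Let s_sep k : (1 <= k)%N -> 2 * s k ^+ 2 <= s k.+1 ^+ 2.
Proof. by move=> k1; apply: ltW; exact: scale_sqr_sep. Qed.

Lemma levy_measure_scale : levy_measure mu.
Proof. exact: levy_measure_levy_density. Qed.

(** Lets the control inequality at z = 0 give 1 <= f(1). *)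
Lemma Re_levy_exponent0 : complex.Re (levy_exponent mu 0) = 0.
Proof.
rewrite /levy_exponent /cintegral /= (@eq_Rintegral _ _ _ mu _ (cst 0)).
  by rewrite Rintegral_cst ?mul0r.
by move=> x _; rewrite /= mul0r cos0 subrr.
Qed.

Let C : R := \int[mu]_(x in `]0, +oo[) Num.min 1 (x : R).

Let C_ge0 : 0 <= C.
Proof.
apply: Rintegral_ge0 => x; rewrite /= in_itv/= andbT => x0.
by rewrite le_min ler01 ltW.
Qed.

(** At z = n_(k+1) the control inequality reads -Im psi <= u f(u) with u = 1 + Re psi <= (C + 9) W
    and -Im psi >= W n_k^2 / 16, where W = n_k^(2 + 2 alpha). Monotonicity replaces f(u) by f(x),
    and W cancels. *)
Lemma control_ge (f : R -> R) (k : nat) (x : R) :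
  controls (levy_exponent mu) f -> (1 <= k)%N -> (C + 9) * s k ^+ 4 <= x ->
  s k ^+ 2 <= 16 * (C + 9) * f x.
Proof.
move=> [fnd _ fctl] k1 xk.
have c0 := C_ge0; have w8 := scale_ge8 alpha_gt alpha_lt k1.
have v8 := scale_ge8 alpha_gt alpha_lt (ltn0Sn k).
have v1 : 1 <= s k.+1 by lra.
have v2 : 2 <= s k.+1 by lra.
have /andP[re0 reM] :=
  Re_levy_exponent_scale_le alpha_gt0 alpha_lt s1_ge1 s_sep k1 v1.
have im := Im_levy_exponent_scale_le alpha_gt0 alpha_lt s1_ge1 s_sep k1 v2.
rewrite -/mu -/C in re0 reM im.
have /norm_1_add_ge_Im := fctl (s k.+1).
have massM := scale_mass_le alpha_gt alpha_lt k1.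
have growth := scale_powR_ge alpha_gt alpha_lt k1.
move: reM im massM growth re0.
set M := _ `^ (1 + alpha); set W := _ `^ (2 + 2 * alpha).
set I := complex.Im _; set r := complex.Re _ => reM im massM growth re0 ctl.
have w0 : 0 <= s k by lra.
have W1 : 1 <= W.
  rewrite /W -[leLHS](powRr0 (s k)); apply: ler_powR; first lra.
  by rewrite addr_ge0// mulr_ge0// ltW.
have W4 : W <= s k ^+ 4.
  rewrite /W -[s k ^+ 4]powR_mulrn//; apply: ler_powR; first lra.
  by have := alpha_lt; lra.
have CW : 0 <= C * (W - 1) by rewrite mulr_ge0// subr_ge0.
(* The tail mass [M] is at most 4 W, so 1 + C + 2 M <= (1 + C + 8) W, using W >= 1. *)
have uA : 1 + r <= (C + 9) * W by lra.
(* The piece gives at least W n_k^2 / 8, and the tail removes at most 4 W <= W n_k^2 / 16 because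
   n_k >= 8. *)
have {}im : W * s k ^+ 2 / 16 <= - I.
  have vE : (s k.+1 ^+ 2) `^ alpha / (8 * s k.+1) =
      (s k.+1 ^+ 2) `^ alpha / s k.+1 / 8.
    by field; rewrite gt_eqF//; lra.
  rewrite vE in im.
  have w64 : 8 * 8 <= s k ^+ 2 by rewrite expr2 ler_pM//; lra.
  have : 0 <= W * (s k ^+ 2 - 64) by rewrite mulr_ge0; lra.
  lra.
have u1 : 1 <= 1 + r by lra.
have A1 : 1 <= (C + 9) * W by lra.
have xA : (C + 9) * W <= x.
  by apply: le_trans xk; rewrite ler_wpM2l//; lra.
have fu0 : 0 < f (1 + r).
  rewrite -(@pmulr_rgt0 _ (1 + r)); last by lra.
  apply: lt_le_trans ctl; apply: lt_le_trans im.
  by rewrite divr_gt0// mulr_gt0 ?exprn_gt0//; lra.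
have fux : f (1 + r) <= f x by apply: fnd => //; lra.
have : W * s k ^+ 2 / 16 <= (C + 9) * W * f x.
  apply: (le_trans im); apply: (le_trans ctl).
  by apply: ler_pM => //; [lra|exact: ltW].
rewrite [leRHS]mulrAC [leRHS]mulrC -mulrA ler_pM2l; last by lra.
lra.
Qed.

Lemma not_controls_levy_exponent (f : R -> R) :
  ~ controls (levy_exponent mu) f.
Proof.
move=> ctl; have [fnd [N [N1 intf]] fctl] := ctl.
have c0 := C_ge0.
have f1 : 1 <= f 1.
  have /norm_1_add_ge_Re := fctl 0.
  by rewrite Re_levy_exponent0 addr0 mul1r.
(* [B] is the constant of [ln_scale_le]. [L0] bounds 1 + ln x below the first threshold (C + 9)
   n_1^4; between the thresholds of n_k and n_(k+1), 1 + ln x is at most [L] times n_k. *)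
pose B := 1 / (2 * alpha - 1) + vartheta alpha.
pose L0 := 1 + ln ((C + 9) * s 1%N ^+ 4).
pose L := 1 + ln (C + 9) + 4 * B.
have B0 : 0 <= B.
  have := vartheta_ge2 alpha_gt alpha_lt => t2.
  rewrite addr_ge0//; last by lra.
  by rewrite divr_ge0//; have := alpha_gt; lra.
have L1 : 1 <= L.
  have : 0 <= ln (C + 9) by apply: ln_ge0; lra.
  by rewrite /L; lra.
suff K (x : R) : 1 <= x ->
    (1 + ln x) ^+ 2 <= (L0 ^+ 2 + L ^+ 2 * (16 * (C + 9))) * f x.
  have K0 : 0 < L0 ^+ 2 + L ^+ 2 * (16 * (C + 9)).
    by rewrite ltr_wpDl ?sqr_ge0// mulr_gt0 ?exprn_gt0//; lra.
  by have := sqr_ln_integral_lty fnd K0 N1 K; rewrite intf ltxx.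
move=> x1; have fx1 : 1 <= f x by apply: le_trans f1 _; exact: fnd.
have lx0 := ln_ge0 x1.
have exm : exists m, x < (C + 9) * s m.+1 ^+ 4.
  have [m xm] : exists m : nat, x < m%:R.
    by exists (Num.bound x); apply: archi_boundP; lra.
  exists m; apply: (lt_le_trans xm).
  have sm : m.+1%:R <= s m.+1 by apply: scale_ge_nat.
  have s8 := scale_ge8 alpha_gt alpha_lt (ltn0Sn m).
  have s4 : s m.+1 <= s m.+1 ^+ 4 by rewrite -[leLHS]expr1 ler_weXn2l//; lra.
  have : 0 <= C * s m.+1 ^+ 4 by rewrite mulr_ge0// exprn_ge0//; lra.
  have : m%:R <= m.+1%:R :> R by rewrite ler_nat.
  by lra.
(* The least such [m] locates x between consecutive thresholds; m = 0 means below the first one,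
   where f(x) >= 1 suffices. *)
case: (ex_minnP exm) => m xm mmin.
have s0 k : 0 < s k.+1.
  by have := scale_ge8 alpha_gt alpha_lt (ltn0Sn k); lra.
have lnxm : ln x <= ln (C + 9) + 4 * ln (s m.+1).
  have -> : ln (C + 9) + 4 * ln (s m.+1) = ln ((C + 9) * s m.+1 ^+ 4).
    by rewrite lnM ?posrE ?exprn_gt0//; [rewrite lnXn// mulr_natl|lra].
  rewrite ler_ln ?posrE ?mulr_gt0 ?exprn_gt0//; lra.
have KL : 0 <= L ^+ 2 * (16 * (C + 9)) by rewrite mulr_ge0 ?sqr_ge0//; lra.
case: m xm mmin lnxm => [|m] xm mmin lnxm.
  have H : (1 + ln x) ^+ 2 <= L0 ^+ 2.
    have lL0 : 1 + ln x <= L0.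
      rewrite /L0 lerD2l ler_ln ?posrE ?mulr_gt0 ?exprn_gt0//; lra.
    by rewrite !expr2; apply: ler_pM => //; lra.
  apply: (le_trans H); apply: (@le_trans _ _ (L0 ^+ 2 * f x)).
    by rewrite ler_peMr ?sqr_ge0.
  by rewrite ler_wpM2r//; lra.
have xm' : (C + 9) * s m.+1 ^+ 4 <= x.
  by rewrite leNgt; apply/negP => /mmin; rewrite ltnn.
have fk := control_ge ctl (ltn0Sn m) xm'.
have lns := ln_scale_le alpha_gt alpha_lt (ltn0Sn m); rewrite -/B in lns.
have s8 := scale_ge8 alpha_gt alpha_lt (ltn0Sn m).
(* The constant 1 + ln(C + 9) is absorbed because the scale is at least 1. *)
have lL : 1 + ln x <= L * s m.+1.
  have l9 : 0 <= ln (C + 9) by apply: ln_ge0; lra.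
  have : 0 <= (1 + ln (C + 9)) * (s m.+1 - 1) by rewrite mulr_ge0; lra.
  by rewrite /L; lra.
apply: (@le_trans _ _ ((L * s m.+1) ^+ 2)).
  by rewrite !expr2; apply: ler_pM => //; lra.
rewrite exprMn; apply: (@le_trans _ _ (L ^+ 2 * (16 * (C + 9) * f x))).
  by rewrite ler_wpM2l ?sqr_ge0.
by rewrite [leRHS]mulrDl mulrA lerDr mulr_ge0 ?sqr_ge0//; lra.
Qed.

End no_control.

Theorem mainTheorem12 (R : realType) (alpha : R)
    (alpha_gt : 1 / 2 < alpha) (alpha_lt : alpha < 1) :
  exists (n1 : nat) (c : R),
    [/\ (2 <= n1)%N, 0 < c,
      forall k : nat, (2 <= k)%N ->
        2 * scale alpha c n1 k.-1 ^+ 2 < scale alpha c n1 k ^+ 2 &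
      let mu : {measure set (measurableTypeR R) -> \bar R} :=
        levy_density_measure alpha (scale alpha c n1) in
      [/\ levy_measure mu,
        ~ (exists f : R -> R, controls (levy_exponent mu) f) &
        forall (d : measure_display) (Omega : measurableType d)
          (P : probability Omega R) (X : R -> {RV P >-> R}) (psi : R -> R[i]),
          driftless_subordinator X mu -> is_exponent X psi ->
          ~ (exists f : R -> R, controls psi f)]].
Proof.
exists 8, 1; split => //.
  by case=> [|[|k]] // _; exact: scale_sqr_sep.
have nctl := not_controls_levy_exponent alpha_gt alpha_lt.
split.
- exact: levy_measure_scale.
- by case=> f; exact: nctl.
move=> d Omega P X psi [_ _ _ Xexp] Xpsi [f].
by rewrite (is_exponent_unique Xpsi Xexp); exact: nctl.
Qed.
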